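(* Let $H$ and $K$ be groups and assume $Z(H)=1$. Then there exists a group $G$ containing a normal subgroup $N$ such that: (i) $N$ is isomorphic to the direct product of $\kappa$ copies of $H$, where $\kappa=\max\{\aleph_0,|K|\}$; (ii) $G/N\simeq K$; (iii) $N$ is a hereditary Aut-basis of $G$.
   Context: A subset $X$ of a group $G$ is an Aut-basis of $G$ if any two automorphisms of $G$ having the same restriction to $X$ are equal (equivalently, the only automorphism of $G$ fixing every element of $X$ is the identity). A subset $X$ of $G$ is a hereditary Aut-basis of $G$ if it is an Aut-basis of every subgroup of $G$ containing it. $Z(H)$ denotes the centre of $H$. ''Direct product'' of infinitely many copies means the restricted direct product (elements with finitely many nontrivial components), as opposed to the cartesian product.
   Formalization: H is additionally assumed to be nontrivial; for H = 1 the claim fails, e.g. with K cyclic of order 3, where N = 1, G is isomorphic to K, and inversion is a nontrivial automorphism of G fixing N. *)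

(* Defs.v *)
From HB Require Import structures.
From mathcomp Require Import all_boot.
From mathcomp Require Import mathcomp_extra boolp classical_sets functions
  cardinality.

Set Implicit Arguments.
Unset Strict Implicit.
Unset Printing Implicit Defensive.

Local Open Scope classical_set_scope.
Local Open Scope card_scope.
Local Open Scope quotient_scope.
Local Open Scope group_scope.

(* Groups are arbitrary, possibly infinite [groupType]s. Subgroups are
   boolean predicates, which by the classical axioms of [boolp] cover all
   subsets: [set G] and [{pred G}] are in bijection. *)

Definition center (H : groupType) : set H := [set z | forall x, commute z x].

Definition isomorphic (G H : groupType) : Prop :=
  exists f : {multiplicative G -> H}, bijective f.

Definition subgroup_type (G : groupType) (S : groupClosed G) : Type :=
  {x : G | x \in S}.

Section SubgroupType.
Variables (G : groupType) (S : groupClosed G).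

HB.instance Definition _ := [isSub of subgroup_type S for @sval G _].
HB.instance Definition _ := [Choice of subgroup_type S by <:].

Lemma subgroup_type_closed : group_closed (fun x => x \in S).
Proof. by split=> [|x y xS yS]; [exact: gpred1 | exact: gpredF]. Qed.

HB.instance Definition _ := SubChoice_isSubGroup.Build G _ (subgroup_type S)
  subgroup_type_closed.

End SubgroupType.

HB.mixin Record isConjClosed (G : groupType) (S : {pred G}) := {
  gpredJr : forall x y : G, x \in S -> x ^ y \in S
}.

#[short(type="normalSubgroup")]
HB.structure Definition NormalSubgroup (G : groupType) :=
  {S of GroupClosed G S & isConjClosed G S}.

Module GroupQuotient.
Section GroupQuotient.
Variables (G : groupType) (N : normalSubgroup G).

(* the classes are the cosets x N *)
Definition equiv (x y : G) := x^-1 * y \in N.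

Lemma equiv_is_equiv : equiv_class_of equiv.
Proof.
split=> [x|x y|y x z]; rewrite /equiv.
- by rewrite mulVg gpred1.
- by rewrite -gpredV invgM invgK.
- move=> xy yz; rewrite -[z](mulVKg y) mulgA.
  exact: gpredM.
Qed.

Canonical equiv_equiv := EquivRelPack equiv_is_equiv.
Canonical equiv_encModRel := defaultEncModRel equiv.

Definition quot := {eq_quot equiv}.

#[export]
HB.instance Definition _ : EqQuotient G equiv quot := EqQuotient.on quot.
#[export]
HB.instance Definition _ := Choice.on quot.

Definition one : quot := lift_cst quot 1.
Definition mul := lift_op2 quot *%g.
Definition inv := lift_op1 quot (fun x : G => x^-1).

Canonical pi_one_morph := PiConst one.

Lemma equiv_pi x : equiv (repr (\pi_quot x)) x.
Proof. by rewrite -eqmodE reprK. Qed.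

Lemma pi_inv : {morph \pi_quot : x / x^-1 >-> inv x}.
Proof.
move=> x; unlock inv; apply/eqP; rewrite piE /equiv invgK.
set r := repr _.
have rx : r^-1 * x \in N by exact: equiv_pi.
have -> : x * r^-1 = (r^-1 * x) ^ r^-1.
  by rewrite conjgE invgK mulgA mulVKg.
exact: gpredJr.
Qed.
Canonical pi_inv_morph := PiMorph1 pi_inv.

Lemma pi_mul : {morph \pi_quot : x y / x * y >-> mul x y}.
Proof.
move=> x y; unlock mul; apply/eqP; rewrite eq_sym piE /equiv.
set r := repr _; set s := repr _.
have rx : r^-1 * x \in N by exact: equiv_pi.
have sy : s^-1 * y \in N by exact: equiv_pi.
have -> : (r * s)^-1 * (x * y) = (r^-1 * x) ^ s * (s^-1 * y).
  by rewrite conjgE invgM !mulgA mulgK.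
by apply: gpredM => //; exact: gpredJr.
Qed.
Canonical pi_mul_morph := PiMorph2 pi_mul.

Lemma mulqA : associative mul.
Proof. by move=> x y z; rewrite -[x]reprK -[y]reprK -[z]reprK !piE mulgA. Qed.

Lemma mul1q : left_id one mul.
Proof. by move=> x; rewrite -[x]reprK !piE mul1g. Qed.

Lemma mulq1 : right_id one mul.
Proof. by move=> x; rewrite -[x]reprK !piE mulg1. Qed.

Lemma mulVq : left_inverse one inv mul.
Proof. by move=> x; rewrite -[x]reprK !piE mulVg. Qed.

Lemma mulqV : right_inverse one inv mul.
Proof. by move=> x; rewrite -[x]reprK !piE mulgV. Qed.

#[export]
HB.instance Definition _ := isGroup.Build quot mulqA mul1q mulq1 mulVq mulqV.

End GroupQuotient.
Module Exports. HB.reexport. End Exports.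
End GroupQuotient.
Export GroupQuotient.Exports.

Notation quotient_group := GroupQuotient.quot.

Definition cartesian_power (I : Type) (H : groupType) : Type := I -> H.

Section CartesianPower.
Variables (I : Type) (H : groupType).
Notation P := (cartesian_power I H).
Implicit Types f g h : P.

HB.instance Definition _ := Choice.copy P (I -> H).

Definition cart_one : P := fun=> 1.
Definition cart_mul f g : P := fun i => f i * g i.
Definition cart_inv f : P := fun i => (f i)^-1.

Lemma cart_mulgA : associative cart_mul.
Proof. by move=> f g h; apply/funext => i; exact: mulgA. Qed.
Lemma cart_mul1g : left_id cart_one cart_mul.
Proof. by move=> f; apply/funext => i; exact: mul1g. Qed.
Lemma cart_mulg1 : right_id cart_one cart_mul.
Proof. by move=> f; apply/funext => i; exact: mulg1. Qed.
Lemma cart_mulVg : left_inverse cart_one cart_inv cart_mul.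
Proof. by move=> f; apply/funext => i; exact: mulVg. Qed.
Lemma cart_mulgV : right_inverse cart_one cart_inv cart_mul.
Proof. by move=> f; apply/funext => i; exact: mulgV. Qed.

HB.instance Definition _ :=
  isGroup.Build P cart_mulgA cart_mul1g cart_mulg1 cart_mulVg cart_mulgV.

Definition finite_support : {pred P} :=
  fun f => `[< finite_set [set i | f i <> 1] >].

Lemma finite_support_closed : group_closed finite_support.
Proof.
split=> [|f g /asboolP fF /asboolP gF].
  apply/asboolP; rewrite [X in finite_set X](_ : _ = set0) //.
  by rewrite -subset0 => i /=.
apply/asboolP; apply: (@sub_finite_set _ _
    ([set i | f i <> 1] `|` [set i | g i <> 1])); last by rewrite finite_setU.
move=> i /= fg; apply: contrapT => /not_orP[/contrapT fi /contrapT gi].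
by apply: fg; rewrite [LHS](_ : _ = f i / g i) // fi gi divg1.
Qed.

HB.instance Definition _ :=
  isInvClosed.Build P finite_support (group_closedV finite_support_closed).
HB.instance Definition _ :=
  isMulClosed.Build P finite_support (group_closedM finite_support_closed).
HB.instance Definition _ :=
  isMul1Closed.Build P finite_support finite_support_closed.1.

End CartesianPower.

Definition direct_power (I : Type) (H : groupType) : groupType :=
  subgroup_type (@finite_support I H : groupClosed (cartesian_power I H)).

(* |T| = max {|U|, |V|} *)
Definition card_is_max (T U V : Type) : Prop :=
  ([set: U] #<= [set: V] /\ [set: T] #= [set: V]) \/
  ([set: V] #<= [set: U] /\ [set: T] #= [set: U]).

Definition aut_basis (G : groupType) (X : set G) : Prop :=
  forall f g : {multiplicative G -> G}, bijective f -> bijective g ->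
    (forall x, X x -> f x = g x) -> f =1 g.

Definition hereditary_aut_basis (G : groupType) (X : set G) : Prop :=
  forall S : groupClosed G, X `<=` [set` S] ->
    aut_basis [set x : subgroup_type S | X (val x)].

(* Main.v *)
Require Import Defs.
From HB Require Import structures.
From mathcomp Require Import all_boot.
From mathcomp Require Import boolp classical_sets functions cardinality.

Set Implicit Arguments.
Unset Strict Implicit.
Unset Printing Implicit Defensive.

Local Open Scope classical_set_scope.
Local Open Scope card_scope.
Local Open Scope quotient_scope.
Local Open Scope group_scope.

(** The group [G] is the restricted wreath product of [H] by [K], that is
    [H^(I) ><| K], where [K] permutes the coordinates of the direct power
    [H^(I)] through a faithful action on [I], and [N] is the base group
    [H^(I)]. Such an action exists because [K] injects into [I]: let [K] act
    by left translation on the image of the injection and trivially off it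
    ([faithful_action_exists]).

    Only the identity commutes with all of [N] ([wreath_base_centralizer]). Indeed
    its component in [K] fixes every point of [I], as otherwise it would carry
    an element supported at one point to an element supported at another one;
    and then each coordinate of its component in [H^(I)] is central in [H].

    A normal subgroup [N] with trivial centralizer is a hereditary Aut-basis
    ([trivial_centralizer_hereditary]): if [f] and [g] agree on [N] and
    [f s = g t], then conjugation by [s] and by [t] agree on [N], because
    [g (n ^ s) = f (n ^ s) = f n ^ f s = g n ^ g t = g (n ^ t)]; so [s / t]
    centralizes [N], whence [s = t]. *)

(** * Subgroups with trivial centralizer *)

(** A [{multiplicative G -> H}] is only a magma morphism; these are the
    consequences of cancellation in the target group. *)
Section MultiplicativeMaps.
Variables (G H : groupType) (f : {multiplicative G -> H}).

Lemma multiplicative1 : f 1 = 1.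
Proof. by apply: (mulgI (f 1)); rewrite -gmulfM !mulg1. Qed.

Lemma multiplicativeJ : {morph f : x y / x ^ y}.
Proof.
by move=> x y; apply: (mulgI (f y)); rewrite -conjgC -!gmulfM -conjgC.
Qed.

End MultiplicativeMaps.

(** When the centralizer of [N] is trivial, an element is determined by the
    automorphism of [N] that it induces by conjugation, and an automorphism
    known on [N] transports that information. The hypothesis on the
    centralizer passes to every subgroup containing [N], hence the heredity. *)
Lemma trivial_centralizer_hereditary (G : groupType) (N : normalSubgroup G) :
    (forall x : G, {in N, forall n, commute x n} -> x = 1) ->
  hereditary_aut_basis [set` N].
Proof.
move=> cN1 S NS f g _ [g' gK g'K] fg s.
have [t gt] : exists t, g t = f s by exists (g' (f s)); rewrite g'K.
suff st : s = t by rewrite -gt st.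
apply: val_inj; apply/eqP; rewrite -divg_eq1; apply/eqP; apply: cN1 => n Nn.
pose u : subgroup_type S := Sub n (NS n Nn).
have valJ (x y : subgroup_type S) : val (x ^ y) = val x ^ val y.
  exact: gmulfJ.
(* [u ^ s] is still in [N] by normality, so [f] and [g] agree on it. *)
have ust : u ^ s = u ^ t.
  apply: (can_inj gK); rewrite -fg; last first.
    by change (val (u ^ s) \in N); rewrite valJ gpredJr.
  by rewrite !multiplicativeJ gt fg.
have {}ust : n ^ val s = n ^ val t by have := congr1 val ust; rewrite !valJ.
apply/commute_sym/commgP; rewrite -conjg_fix.
by rewrite conjgM ust conjgK.
Qed.

(** * Semidirect products *)

Record aut_action (K A : groupType) := AutAction {
  aut_act :> K -> {multiplicative A -> A};
  aut_act1 : forall x, aut_act 1 x = x;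
  aut_actM : forall k l x, aut_act (k * l) x = aut_act k (aut_act l x)
}.

(** Keeping [phi] as a parameter of this alias of [A * K] separates its group
    law from the componentwise one, and makes it inferable from the type. *)
Definition semidirect (K A : groupType) (phi : aut_action K A) : Type :=
  (A * K)%type.

Section Semidirect.
Variables (K A : groupType) (phi : aut_action K A).
Notation G := (semidirect phi).
Implicit Types x y : G.

HB.instance Definition _ := Choice.copy G (A * K)%type.

Definition sdpair (a : A) (k : K) : G := (a, k).

Definition sdprod_one : G := sdpair 1 1.
Definition sdprod_mul x y : G := (x.1 * phi x.2 y.1, x.2 * y.2).
Definition sdprod_inv x : G := (phi x.2^-1 x.1^-1, x.2^-1).

Lemma sdprod_mulA : associative sdprod_mul.
Proof. by move=> x y z; congr pair; rewrite /= ?gmulfM ?aut_actM ?mulgA. Qed.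

Lemma sdprod_mul1 : left_id sdprod_one sdprod_mul.
Proof. by case=> a k; congr pair; rewrite /= ?aut_act1 mul1g. Qed.

Lemma sdprod_mulr1 : right_id sdprod_one sdprod_mul.
Proof. by case=> a k; congr pair; rewrite /= ?multiplicative1 mulg1. Qed.

Lemma sdprod_mulV : left_inverse sdprod_one sdprod_inv sdprod_mul.
Proof.
by case=> a k; congr pair; rewrite /= -?gmulfM mulVg ?multiplicative1.
Qed.

Lemma sdprod_mulrV : right_inverse sdprod_one sdprod_inv sdprod_mul.
Proof.
by case=> a k; congr pair; rewrite /= -?aut_actM mulgV ?aut_act1 ?mulgV.
Qed.

HB.instance Definition _ := isGroup.Build G
  sdprod_mulA sdprod_mul1 sdprod_mulr1 sdprod_mulV sdprod_mulrV.

Definition sdprod_base : {pred G} := fun x => x.2 == 1.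

Lemma sdprod_baseE x : (x \in sdprod_base) = (x.2 == 1).
Proof. by []. Qed.

Lemma sdprod_base_closed : group_closed sdprod_base.
Proof.
split=> [|x y]; rewrite !sdprod_baseE // => /eqP x1 /eqP y1.
by rewrite /= x1 y1 divg1.
Qed.

Lemma sdprod_base_conj x y : x \in sdprod_base -> x ^ y \in sdprod_base.
Proof. by rewrite !sdprod_baseE /= => /eqP ->; rewrite mul1g mulVg. Qed.

HB.instance Definition _ :=
  isInvClosed.Build G sdprod_base (group_closedV sdprod_base_closed).
HB.instance Definition _ :=
  isMulClosed.Build G sdprod_base (group_closedM sdprod_base_closed).
HB.instance Definition _ :=
  isMul1Closed.Build G sdprod_base sdprod_base_closed.1.
HB.instance Definition _ := isConjClosed.Build G sdprod_base sdprod_base_conj.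

Definition sdprod_base_fst (x : subgroup_type sdprod_base) : A := (val x).1.

Lemma sdprod_base_fstM : {morph sdprod_base_fst : x y / x * y}.
Proof.
move=> x y; rewrite /sdprod_base_fst gmulfM /=.
by have /eqP -> := valP x; rewrite aut_act1.
Qed.

HB.instance Definition _ := isMultiplicative.Build _ _ sdprod_base_fst
  sdprod_base_fstM.

Lemma sdprod_base_isomorphic : isomorphic (subgroup_type sdprod_base) A.
Proof.
exists sdprod_base_fst.
have aN (a : A) : sdpair a 1 \in sdprod_base by rewrite sdprod_baseE.
exists (fun a => Sub (sdpair a 1) (aN a)) => // x.
by apply: val_inj; case: x => -[a k] /= /[dup] /eqP /= -> ?.
Qed.

Definition sdprod_quot_snd (q : quotient_group sdprod_base) : K := (repr q).2.

Lemma sdprod_quot_sndE x :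
  sdprod_quot_snd (\pi_(quotient_group sdprod_base) x) = x.2.
Proof.
apply: (@mulgI _ (sdprod_quot_snd (\pi_(quotient_group sdprod_base) x))^-1).
rewrite mulVg.
by have /eqP/esym := GroupQuotient.equiv_pi sdprod_base x.
Qed.

Lemma sdprod_quot_snd_bij : bijective sdprod_quot_snd.
Proof.
exists (fun k => \pi_(quotient_group sdprod_base) (sdpair 1 k)) => [q|k].
  rewrite -[q]reprK sdprod_quot_sndE; apply/eqP.
  by rewrite piE /GroupQuotient.equiv sdprod_baseE /= mulVg.
exact: sdprod_quot_sndE.
Qed.

Lemma sdprod_quot_sndM : {morph sdprod_quot_snd : x y / x * y}.
Proof.
move=> p q; rewrite -[p]reprK -[q]reprK.
rewrite -[LHS](congr1 sdprod_quot_snd (GroupQuotient.pi_mul _ _ _)).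
by rewrite !sdprod_quot_sndE.
Qed.

HB.instance Definition _ := isMultiplicative.Build _ _ sdprod_quot_snd
  sdprod_quot_sndM.

Lemma sdprod_quot_isomorphic : isomorphic (quotient_group sdprod_base) K.
Proof. by exists sdprod_quot_snd; exact: sdprod_quot_snd_bij. Qed.

End Semidirect.

Arguments sdprod_base {K A} phi.

(** * Wreath products *)

Record perm_action (K : groupType) (I : Type) := PermAction {
  perm_act :> K -> I -> I;
  perm_act1 : forall i, perm_act 1 i = i;
  perm_actM : forall k l i, perm_act (k * l) i = perm_act k (perm_act l i)
}.

Definition faithful (K : groupType) (I : Type) (a : perm_action K I) : Prop :=
  forall k, (forall i, a k i = i) -> k = 1.

(** Left translation of [K] on itself is faithful; it is transported along an
    injection [e : K -> I] and extended by the identity outside its image.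
    This treats finite, countable and uncountable [K] uniformly. *)
Lemma faithful_action_exists (K : groupType) (I : Type) :
  [set: K] #<= [set: I] -> exists a : perm_action K I, faithful a.
Proof.
move=> /card_leP[f]; pose e k : I := val (f (to_setT k)).
have e_inj : injective e.
  by move=> k l /val_inj/(inj (in_setT _) (in_setT _))/(congr1 val).
pose act k i := if pselect (exists x, i = e x) is left ex then
  e (k * projT1 (cid ex)) else i.
have actE k x : act k (e x) = e (k * x).
  rewrite /act; case: pselect => [ex|[]]; last by exists x.
  by case: cid => y /= /e_inj ->.
have act_out k i : ~ (exists x, i = e x) -> act k i = i.
  by rewrite /act; case: pselect.
have act1 i : act 1 i = i.
  have [[x ->]|/act_out ->//] := pselect (exists x, i = e x).
  by rewrite actE mul1g.
have actM k l i : act (k * l) i = act k (act l i).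
  have [[x ->]|no] := pselect (exists x, i = e x); first by rewrite !actE mulgA.
  by rewrite !(act_out _ i).
exists (PermAction act1 actM) => k /(_ (e 1)) /=.
by rewrite actE mulg1 => /e_inj.
Qed.

Section Wreath.
Variables (H K : groupType) (I : Type) (a : perm_action K I).
Notation B := (direct_power I H).
Implicit Types x y : B.

Lemma finite_support_shift k x :
  (fun i => val x (a k^-1 i)) \in @finite_support I H.
Proof.
apply/asboolP; have /asboolP/(finite_image (a k)) := valP x.
apply: sub_finite_set => i /= xi; exists (a k^-1 i) => //.
by rewrite -perm_actM mulgV perm_act1.
Qed.

(** The inverse of [k] turns precomposition into a left action. *)
Definition shift k x : B := exist (fun f => f \in @finite_support I H) _
  (finite_support_shift k x).

Lemma shiftM k : {morph shift k : x y / x * y}.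
Proof. by move=> x y; apply: val_inj. Qed.

HB.instance Definition _ k := isMultiplicative.Build B B (shift k) (shiftM k).

Lemma shift1 x : shift 1 x = x.
Proof.
by apply: val_inj; apply/funext => i; rewrite /= invg1 perm_act1.
Qed.

Lemma shift_comp k l x : shift (k * l) x = shift k (shift l x).
Proof.
by apply: val_inj; apply/funext => i; rewrite /= invgM perm_actM.
Qed.

Definition shift_action : aut_action K B :=
  @AutAction K B (fun k => shift k) shift1 shift_comp.

Notation wreath := (semidirect shift_action).

Lemma finite_support_delta i (h : H) :
  (fun j => if `[< j = i >] then h else 1) \in @finite_support I H.
Proof.
apply/asboolP; apply: sub_finite_set (finite_set1 i) => j /=.
by case: asboolP.
Qed.

Definition delta i h : B := exist (fun f => f \in @finite_support I H) _
  (finite_support_delta i h).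

Lemma deltaE i h : val (delta i h) i = h.
Proof. by rewrite /=; case: asboolP. Qed.

Lemma delta_neq i j h : j <> i -> val (delta i h) j = 1.
Proof. by rewrite /=; case: asboolP. Qed.

(** The test elements are the [delta i h]: they detect first that the
    permutation part is trivial, then that the remaining function takes its
    values in the centre of [H]. *)
Lemma wreath_base_centralizer (x : wreath) :
    (exists h : H, h <> 1) -> @center H = [set 1] -> faithful a ->
  {in sdprod_base shift_action, forall n, commute x n} -> x = 1.
Proof.
move=> [h0 h01] cH fa; case: x => f k cx.
(* Coordinate [i] of [(f, k) * (n, 1) = (n, 1) * (f, k)]. *)
have {}cx (n : B) i : val f i * val n (a k^-1 i) = val n i * val f i.
  have cfn : commute (sdpair shift_action f k) (sdpair shift_action n 1).
    by apply: cx; rewrite sdprod_baseE.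
  have : val f i * val n (a k^-1 i) = val n i * val f (a 1^-1 i).
    by move: cfn => /(congr1 (fun y : wreath => val y.1 i)).
  by rewrite invg1 perm_act1.
have fix_k i : a k^-1 i = i.
  apply: contrapT => ki; apply: h01.
  (* At [i] the left-hand side receives [h0], moved there by [k]; the
     right-hand side only has [1]. *)
  have := cx (delta (a k^-1 i) h0) i.
  rewrite deltaE delta_neq; last by move/esym.
  by rewrite mul1g -[RHS]mulg1 => /mulgI.
have k1 : k = 1 by apply: invg_inj; rewrite invg1; apply: fa.
congr pair => //; apply: val_inj; apply/funext => i /=.
have : center (val f i).
  by move=> h; have := cx (delta i h) i; rewrite fix_k deltaE.
by rewrite cH.
Qed.

End Wreath.

Theorem corollary1p5 (H K : groupType) (I : Type)
    (H_nontrivial : exists h : H, h <> 1)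
    (H_centerless : @center H = [set 1])
    (I_card : card_is_max I nat K) :
  exists (G : groupType) (N : normalSubgroup G),
    [/\ isomorphic (subgroup_type N) (direct_power I H),
        isomorphic (quotient_group N) K
      & hereditary_aut_basis [set` N]].
Proof.
have [a fa] : exists a : perm_action K I, faithful a.
  apply: faithful_action_exists.
  case: I_card => -[le_max /card_eqPle[_ I_max]] //.
  exact: card_le_trans I_max.
pose N : normalSubgroup (semidirect (shift_action H a)) := sdprod_base _.
exists (semidirect (shift_action H a)), N; split.
- exact: sdprod_base_isomorphic.
- exact: sdprod_quot_isomorphic.
- apply: trivial_centralizer_hereditary => x.
  exact: wreath_base_centralizer.
Qed.
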